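(* Let $\ell,\mu,\omega$ be real constants with $\omega>0$. Let $\Phi$ be a solution of the Riccati equation $$\Phi'(z)=\frac{1}{2\mathrm{i}\omega z}\bigl(1-\Phi(z)^2\bigr)+\Bigl(\frac{\ell}{z}+\mu\bigl(1+z^{-2}\bigr)\Bigr)\Phi(z)$$ holomorphic in some vicinity of the punctured circle ${}^\backprime S^1=\{z\in\mathbb{C}:|z|=1,\ z\ne-1\}$, and let $\Psi$ be a solution of the linear homogeneous first order equation $$2\mathrm{i}\omega z\,\Psi'(z)=\bigl(\Phi(z)+\Phi(z)^{-1}\bigr)\Psi(z).$$ Suppose that $\Psi(1)=1$ and $|\Phi(1)|=1$. Let $T=2\pi/\omega$, let $\varphi$ be the continuous (and then necessarily real analytic) real function determined by $\Phi(e^{\mathrm{i}\omega t})=e^{\mathrm{i}\varphi(t)}$, $t\in(-T/2,T/2)$ (and by its limits at $t=\pm T/2$), and let $P(t)=\int_0^t\cos\varphi(\tau)\,d\tau$. Then the formula $$\Phi_M(z)=\frac{e^{\frac12P(\frac T2)}\cos\varphi(\tfrac T2)\,\Psi(z)^{\frac12}\Phi(z)^{\frac12}+\mathrm{i}\,e^{\frac12P(-\frac T2)}\sin\tfrac12\bigl(\varphi(\tfrac T2)-\varphi(-\tfrac T2)\bigr)\,\Psi(1/z)^{\frac12}\Phi(1/z)^{-\frac12}}{e^{\frac12P(\frac T2)}\cos\varphi(\tfrac T2)\,\Psi(z)^{\frac12}\Phi(z)^{-\frac12}-\mathrm{i}\,e^{\frac12P(-\frac T2)}\sin\tfrac12\bigl(\varphi(\tfrac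 T2)-\varphi(-\tfrac T2)\bigr)\,\Psi(1/z)^{\frac12}\Phi(1/z)^{\frac12}}$$ yields the explicit representation of the result $\Phi_M$ of the monodromy transformation of the function $\Phi$.
   Context: Solutions $\Phi$ of the Riccati equation are considered on the slit plane $\mathbb{C}\setminus\mathbb{R}_{\le0}$ (with their isolated singular points removed), which is identified with a sub-domain of the universal cover of $\mathbb{C}^*=\mathbb{C}\setminus\{0\}$. The two edges of the cut along the negative real axis are distinguished: $\rho e^{\mathrm{i}\pi}$ (resp. $\rho e^{-\mathrm{i}\pi}$), $\rho>0$, denotes the point of the edge adjacent to the upper (resp. lower) half-plane, with $1/(\rho e^{\pm\mathrm{i}\pi})=\rho^{-1}e^{\mp\mathrm{i}\pi}$. Relation to the real equation: a solution $\Phi$ with $|\Phi(1)|=1$ satisfies $|\Phi|=1$ on ${}^\backprime S^1$, and $\Phi(e^{\mathrm{i}\omega t})=e^{\mathrm{i}\varphi(t)}$ where the real function $\varphi$ solves $\dot\varphi+\sin\varphi=B+A\cos\omega t$ with $A=2\omega\mu$, $B=\omega\ell$. Such $\varphi$ extends to a solution on all of $\mathbb{R}$; $\varphi(\pm T/2)$ are its values at $\pm T/2$, so $\Phi(e^{\pm\mathrm{i}\pi})=e^{\mathrm{i}\varphi(\pm T/2)}$. Monodromy transformation: $\Phi_M$ is the solution of the same Riccati equation obtained from $\Phi$ by pointwise analytic continuation along the full circles centered at zero passed once counter-clockwise (or along homotopic curves avoiding the singularities of $\Phi$). Equivalently, $\Phi_M(e^{\mathrm{i}\omega t})=e^{\mathrm{i}\varphi(t+T)}$;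 equivalently, $\Phi_M$ is the solution of the Riccati equation with $\Phi_M(e^{-\mathrm{i}\pi})=\Phi(e^{\mathrm{i}\pi})$. Branches: $\Psi(e^{\mathrm{i}\omega t})=e^{P(t)}$; the function $\Psi^{1/2}$ is the analytic continuation of $e^{P(t)/2}$ (from $z=e^{\mathrm{i}\omega t}$, $t\in(-T/2,T/2)$), and $\Phi^{\pm1/2}$ are the analytic continuations of $e^{\pm\mathrm{i}\varphi(t)/2}$.
   Formalization: The quotient formula is asserted only for Φ(1) ≠ ±i, since for Φ(1) = ±i its numerator and denominator vanish identically (e.g. μ=0, ℓω=1, Φ≡i gives 0/0); in all cases the identity Φ_M · denominator = numerator is asserted. *)

(* Defs.v *)
From Stdlib Require Import Reals.
From Coquelicot Require Import Coquelicot.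
Open Scope R_scope.

(* Complex derivatives are Coquelicot's [is_derive] over the valued field C. *)

Definition expi (theta : R) : C := (cos theta, sin theta).

(* The circle is punctured at -1. *)
Definition punctured_circle (z : C) : Prop := Cmod z = 1 /\ z <> RtoC (-1).

Definition slit_plane (z : C) : Prop := ~ (Im z = 0 /\ Re z <= 0).

Definition connected (U : C -> Prop) : Prop :=
  forall A B : C -> Prop,
    open A -> open B ->
    (forall z, U z -> A z \/ B z) ->
    (forall z, U z -> A z -> B z -> False) ->
    (exists z, U z /\ A z) ->
    forall z, U z -> A z.

(* Removed singular points are modelled by points left out of [U]. *)
Definition circle_vicinity (U : C -> Prop) : Prop :=
  open U /\ connected U /\
  (forall z, U z -> slit_plane z) /\
  (forall z, punctured_circle z -> U z).

Definition riccati_rhs (l mu om : R) (z y : C) : C :=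
  (/ (2 * Ci * om * z) * (1 - y * y) + (l / z + mu * (1 + / (z * z))) * y)%C.

Definition riccati_at (l mu om : R) (Phi : C -> C) (z : C) : Prop :=
  is_derive Phi z (riccati_rhs l mu om z (Phi z)).

Definition riccati_solution (l mu om : R) (U : C -> Prop) (Phi : C -> C) : Prop :=
  forall z, U z -> riccati_at l mu om Phi z.

(* The zeros of [Phi] are singular points of this linear equation, so its
   solutions are only considered away from them. *)
Definition psi_solution (om : R) (U : C -> Prop) (Phi Psi : C -> C) : Prop :=
  forall z, U z ->
    Phi z <> RtoC 0 /\
    exists d : C, is_derive Psi z d /\
      (2 * Ci * om * z * d = (Phi z + / Phi z) * Psi z)%C.

Definition period (om : R) : R := 2 * PI / om.

(* [phi (T/2)] and [phi (-T/2)] are the one-sided limits, that is, the values on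
   the two edges of the cut; [phi] is unconstrained beyond them. *)
Definition is_phase (om : R) (Phi : C -> C) (phi : R -> R) : Prop :=
  let h := period om / 2 in
  (forall t, - h < t < h -> continuous phi t /\ Phi (expi (om * t)) = expi (phi t)) /\
  filterlim phi (at_left h) (locally (phi h)) /\
  filterlim phi (at_right (- h)) (locally (phi (- h))).

Definition phase_integral (phi : R -> R) (t : R) : R :=
  RInt (fun tau => cos (phi tau)) 0 t.

(* The branch on [U] of the square root of [f] which continues the values
   [w t] prescribed at [exp (i om t)], [-T/2 < t < T/2]. *)
Definition is_sqrt_branch (om : R) (U : C -> Prop) (f : C -> C) (w : R -> C)
    (s : C -> C) : Prop :=
  (forall z, U z -> ex_derive s z /\ (s z * s z)%C = f z) /\
  (forall t, - (period om / 2) < t < period om / 2 -> s (expi (om * t)) = w t).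

(* Analytic continuation, from the germ of [f] at [gamma a] to the germ of [g]
   at [gamma b], along [gamma] on [a, b], by function elements [F s] given near
   [gamma s] that agree locally.  Analytic continuation of a solution of the
   Riccati equation consists of solutions, whence the first clause. *)
Definition riccati_continuation (l mu om : R) (gamma : R -> C) (a b : R)
    (f g : C -> C) : Prop :=
  exists F : R -> C -> C,
    (forall s, a <= s <= b -> locally (gamma s) (riccati_at l mu om (F s))) /\
    (forall s, a <= s <= b ->
       locally s (fun s' => a <= s' <= b ->
         locally (gamma s') (fun z => F s' z = F s z))) /\
    locally (gamma a) (fun z => F a z = f z) /\
    locally (gamma b) (fun z => F b z = g z).

(* [PhiM] is pinned down on the punctured circle by continuation of [Phi] along
   the full circle, and on the rest of the connected set [W] by being a solution
   there. *)
Definition monodromy_transform (l mu om : R) (W : C -> Prop) (Phi PhiM : C -> C)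
    : Prop :=
  riccati_solution l mu om W PhiM /\
  forall z0, punctured_circle z0 ->
    riccati_continuation l mu om (fun s => (z0 * expi s)%C) 0 (2 * PI) Phi PhiM.

Definition coef_direct (om : R) (phi : R -> R) : C :=
  let h := period om / 2 in
  RtoC (exp (/ 2 * phase_integral phi h) * cos (phi h)).

Definition coef_inverse (om : R) (phi : R -> R) : C :=
  let h := period om / 2 in
  (Ci * RtoC (exp (/ 2 * phase_integral phi (- h))
              * sin (/ 2 * (phi h - phi (- h))))%R)%C.

(* [sPsi] and [sPhi] are the square roots of Psi and Phi. *)
Definition monodromy_num (om : R) (phi : R -> R) (sPsi sPhi : C -> C) (z : C) : C :=
  (coef_direct om phi * sPsi z * sPhi z
   + coef_inverse om phi * sPsi (/ z) * / sPhi (/ z))%C.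

Definition monodromy_den (om : R) (phi : R -> R) (sPsi sPhi : C -> C) (z : C) : C :=
  (coef_direct om phi * sPsi z * / sPhi z
   - coef_inverse om phi * sPsi (/ z) * sPhi (/ z))%C.

(* Main.v *)
Require Import Defs.
From Stdlib Require Import Reals Lra.
From Coquelicot Require Import Coquelicot.
Open Scope R_scope.

(** The square roots x = (Psi Phi)^(1/2) and y = (Psi / Phi)^(1/2) linearise the
    Riccati equation: Phi = x / y, and (x, y) solves a traceless linear system
    ([linear_system], [linear_system_of_riccati]).  The equation is invariant under
    z -> 1/z, which gives a second solution (y(1/z), - x(1/z)) of the same system
    ([linear_system_reflect]).  Every combination of the two yields, as the quotient
    of its components, a solution of the Riccati equation; the formula is the
    combination whose quotient takes the value exp(i phi(T/2)) = Phi(exp(i pi))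
    at the lower edge exp(- i pi) of the cut ([circle_edge]).  As PhiM takes
    that value there too, both agree.

    To speak of the quotient num / den without knowing that den has no zeros, the
    defect PhiM den - num is used: it solves a homogeneous linear equation
    ([riccati_defect]).  It tends to 0 at the lower edge of the cut, so it
    vanishes at 1 by Gronwall's estimate on the second half of the circle of
    continuation ([monodromy_at_1]), and therefore on the whole connected domain
    ([zero_propagates]).

    If den vanishes at one point, then, as num = PhiM den, it solves a scalar
    homogeneous linear equation and vanishes everywhere, and num with it.  At the
    point 1 this leaves cos(phi(0)) = 0 or both coefficients of the formula equal to
    0; the latter makes the Wronskian of the two solutions vanish on the edge of the
    cut, hence at 1, where it is a multiple of cos(phi(0))
    ([circle_wronskian], [degenerate_coefficients]).  In both cases Phi(1) is i or
    - i. *)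

(** * Complex derivatives *)

Lemma slit_plane_neq_0 z : slit_plane z -> z <> RtoC 0.
Proof. intros H E. apply H. rewrite E. simpl. split; lra. Qed.

Lemma RtoC_neq_0 (r : R) : r <> 0 -> RtoC r <> RtoC 0.
Proof. intros H E. apply H. exact (RtoC_inj _ _ E). Qed.

Lemma two_neq_0 : (2 : C) <> RtoC 0.
Proof. apply RtoC_neq_0. lra. Qed.

(** The ascriptions keep [C] in the types, where the carrier of an algebraic
    structure would otherwise be inferred and hide the goals from [ring] and
    [field]. *)
Notation hol f z d := (@is_derive C_AbsRing C_NormedModule (f : C -> C) (z : C) (d : C)).

(** [C] carries two normed-module structures over itself: one on the box
    topology of pairs, one on the topology of the modulus.  A derivative refers
    to the target only through its norm, which is the modulus in both, so
    the general rules for products and compositions can be transferred. *)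
Lemma hol_AbsRing (f : C -> C) (z d : C) :
  @is_derive C_AbsRing (AbsRing_NormedModule C_AbsRing) f z d -> hol f z d.
Proof.
intros [[Hp Hs Hn] H]. split; [split|].
- exact Hp.
- exact Hs.
- exact Hn.
- exact H.
Qed.

Lemma hol_AbsRing_inv (f : C -> C) (z d : C) :
  hol f z d -> @is_derive C_AbsRing (AbsRing_NormedModule C_AbsRing) f z d.
Proof.
intros [[Hp Hs Hn] H]. split; [split|].
- exact Hp.
- exact Hs.
- exact Hn.
- exact H.
Qed.

Lemma hol_plus (f g : C -> C) (z df dg : C) :
  hol f z df -> hol g z dg -> hol (fun w => f w + g w)%C z (df + dg)%C.
Proof. exact (@is_derive_plus C_AbsRing C_NormedModule f g z df dg). Qed.

Lemma hol_minus (f g : C -> C) (z df dg : C) :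
  hol f z df -> hol g z dg -> hol (fun w => f w - g w)%C z (df - dg)%C.
Proof. exact (@is_derive_minus C_AbsRing C_NormedModule f g z df dg). Qed.

Lemma hol_opp (f : C -> C) (z df : C) :
  hol f z df -> hol (fun w => - f w)%C z (- df)%C.
Proof. exact (@is_derive_opp C_AbsRing C_NormedModule f z df). Qed.

Lemma hol_const (a z : C) : hol (fun _ => a) z (RtoC 0).
Proof. exact (@is_derive_const C_AbsRing C_NormedModule a z). Qed.

Lemma hol_id (z : C) : hol (fun w => w) z (RtoC 1).
Proof. apply hol_AbsRing. exact (@is_derive_id C_AbsRing z). Qed.

Lemma hol_mult (f g : C -> C) (z df dg : C) :
  hol f z df -> hol g z dg -> hol (fun w => f w * g w)%C z (df * g z + f z * dg)%C.
Proof.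
intros Hf Hg.
apply hol_AbsRing.
exact (@is_derive_mult C_AbsRing f g z df dg
  (hol_AbsRing_inv _ _ _ Hf) (hol_AbsRing_inv _ _ _ Hg) Cmult_comm).
Qed.

Lemma hol_comp (f g : C -> C) (z df dg : C) :
  hol f (g z) df -> hol g z dg -> hol (fun w => f (g w)) z (dg * df)%C.
Proof.
intros Hf Hg.
exact (@is_derive_comp C_AbsRing C_NormedModule f g z df dg Hf (hol_AbsRing_inv _ _ _ Hg)).
Qed.

Lemma hol_unique (f : C -> C) (z d1 d2 : C) : hol f z d1 -> hol f z d2 -> d1 = d2.
Proof.
intros H1 H2. rewrite <- (is_C_derive_unique f z d1 H1).
exact (is_C_derive_unique f z d2 H2).
Qed.

Lemma locally_Cmod (z : C) (P : C -> Prop) :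
  (exists eps, 0 < eps /\ forall w, Cmod (w - z) < eps -> P w) <-> @locally C_UniformSpace z P.
Proof.
rewrite locally_C. split.
- intros [e [He H]]. exists (mkposreal e He). intros w Hw. apply H. exact Hw.
- intros [e H]. exists e. split. apply cond_pos. intros w Hw. apply H. exact Hw.
Qed.

Lemma hol_ext (f g : C -> C) (z d : C) :
  @locally C_UniformSpace z (fun w => f w = g w) -> hol f z d -> hol g z d.
Proof.
intros H. apply is_derive_ext_loc. rewrite <- locally_C. exact H.
Qed.

Lemma hol_eq (f : C -> C) (z d d' : C) : hol f z d -> d = d' -> hol f z d'.
Proof. intros H <-. exact H. Qed.

(** The remainder of the first order expansion of the inverse is exactly
    (w - z)^2 / (w z^2), which is small against w - z once w stays at distance
    at least |z|/2 from 0. *)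
Lemma hol_inv (z : C) : z <> RtoC 0 -> hol Cinv z (- / (z * z))%C.
Proof.
intros Hz. split.
- apply is_linear_scal_l.
- intros x Hx.
  assert (x = z) as ->.
  { symmetry. exact (@is_filter_lim_locally_unique C_AbsRing (AbsRing_NormedModule C_AbsRing) _ _ Hx). }
  intros eps. rewrite <- locally_C. rewrite <- locally_Cmod.
  assert (Hm : 0 < Cmod z) by (apply Cmod_gt_0; exact Hz).
  exists (Rmin (Cmod z / 2) (eps * (Cmod z) ^ 3 / 2)).
  assert (He := cond_pos eps).
  assert (0 < Cmod z ^ 3) by (apply pow_lt; exact Hm).
  split.
  { apply Rmin_pos. lra. apply Rdiv_lt_0_compat. 2: lra. apply Rmult_lt_0_compat; lra. }
  intros w Hw.
  assert (H1 : Cmod (w - z) < Cmod z / 2) by (eapply Rlt_le_trans; [exact Hw | apply Rmin_l]).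
  assert (H2 : Cmod (w - z) < eps * Cmod z ^ 3 / 2) by (eapply Rlt_le_trans; [exact Hw | apply Rmin_r]).
  assert (Hw2 : Cmod z / 2 < Cmod w).
  { assert (T := Cmod_triangle w (z - w)). replace (w + (z - w))%C with z in T by ring.
    replace (z - w)%C with (- (w - z))%C in T by ring. rewrite Cmod_opp in T. lra. }
  assert (Hw0 : w <> RtoC 0) by (apply Cmod_gt_0; lra).
  change (Cmod ((/ w - / z) - (w - z) * - / (z * z))%C <= eps * Cmod (w - z)).
  replace ((/ w - / z) - (w - z) * - / (z * z))%C with ((w - z) * ((w - z) / (w * (z * z))))%C
    by (field; split; assumption).
  rewrite Cmod_mult. rewrite (Rmult_comm eps).
  apply Rmult_le_compat_l. apply Cmod_ge_0.
  rewrite Cmod_div by (repeat apply Cmult_neq_0; assumption).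
  rewrite !Cmod_mult.
  apply Rmult_le_reg_r with (Cmod w * (Cmod z * Cmod z)).
  { repeat apply Rmult_lt_0_compat; lra. }
  unfold Rdiv. rewrite Rmult_assoc, Rinv_l, Rmult_1_r.
  2: { apply Rgt_not_eq. repeat apply Rmult_lt_0_compat; lra. }
  apply Rle_trans with (eps * Cmod z ^ 3 / 2). lra.
  replace (eps * Cmod z ^ 3 / 2) with (eps * (Cmod z / 2 * (Cmod z * Cmod z))) by field.
  apply Rmult_le_compat_l. lra. apply Rmult_le_compat_r. nra. lra.
Qed.

(** Differentiating s^2 = f gives 2 s s' = f'; the existence of s' has to be
    assumed, since s is only known through its square. *)
Lemma hol_sqrt (s f : C -> C) (z d : C) :
  @ex_derive C_AbsRing C_NormedModule s z ->
  @locally C_UniformSpace z (fun w => s w * s w = f w)%C ->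
  s z <> RtoC 0 -> hol f z d -> hol s z (d / (2 * s z))%C.
Proof.
intros Hd Hs N Hf. assert (He : exists e : C, hol s z e) by exact Hd.
destruct He as [e He]. assert (N2 := two_neq_0).
assert (E : (e * s z + s z * e)%C = d).
{ apply hol_unique with f z. 2: exact Hf.
  apply hol_ext with (fun w => s w * s w)%C. exact Hs. apply hol_mult; exact He. }
refine (hol_eq _ _ _ _ He _). rewrite <- E. field. repeat split; assumption.
Qed.

(** * Curves in the complex plane *)

Notation curve_derive h t d := (@is_derive R_AbsRing C_R_NormedModule (h : R -> C) (t : R) (d : C)).

(** A complex derivative is a real differential: this is what allows
    holomorphic functions to be differentiated along real curves. *)
Lemma hol_filterdiff (f : C -> C) (z d : C) : hol f z d ->
  @filterdiff R_AbsRing C_R_NormedModule C_R_NormedModule f (@locally C_UniformSpace z) (fun y => y * d)%C.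
Proof.
intros [_ H]. split.
- split.
  + intros x y. change ((x + y) * d = x * d + y * d)%C. ring.
  + intros k x. change (@scal R_AbsRing C_R_NormedModule k x * d = @scal R_AbsRing C_R_NormedModule k (x * d)%C)%C.
    destruct x as [x1 x2]; destruct d as [d1 d2].
    apply injective_projections; simpl; unfold scal; simpl; unfold mult; simpl; ring.
  + exists (Cmod d + 1). split. assert (H0 := Cmod_ge_0 d); lra.
    intros x. rewrite <- !Cmod_norm, Cmod_mult.
    assert (H0 := Cmod_ge_0 x); assert (H1 := Cmod_ge_0 d). nra.
- intros x Hx eps.
  assert (x = z) as ->.
  { symmetry. exact (@is_filter_lim_locally_unique R_AbsRing C_R_NormedModule _ _ Hx). }
  specialize (H z (fun P HP => HP) eps).
  rewrite <- locally_C in H. revert H. apply filter_imp. intros w Hw.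
  rewrite <- !Cmod_norm. exact Hw.
Qed.

Lemma curve_comp (f : C -> C) (gam : R -> C) t d dg :
  hol f (gam t) d -> curve_derive gam t dg ->
  curve_derive (fun s => f (gam s)) t (dg * d)%C.
Proof.
intros Hf Hg.
assert (H := filterdiff_comp' gam f t _ _ Hg (hol_filterdiff _ _ _ Hf)).
unfold is_derive. eapply filterdiff_ext_lin. exact H.
intros y. simpl.
destruct dg as [x1 x2]; destruct d as [d1 d2].
apply injective_projections; simpl; unfold scal; simpl; unfold mult; simpl; ring.
Qed.

Lemma curve_derive_Re (h : R -> C) t d : curve_derive h t d ->
  is_derive (fun s => Re (h s)) t (Re d).
Proof.
intros H.
exact (filterdiff_comp' h fst t _ _ H (filterdiff_linear _ is_linear_fst)).
Qed.
Lemma curve_derive_Im (h : R -> C) t d : curve_derive h t d ->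
  is_derive (fun s => Im (h s)) t (Im d).
Proof.
intros H.
exact (filterdiff_comp' h snd t _ _ H (filterdiff_linear _ is_linear_snd)).
Qed.

Lemma curve_derive_pair (u v : R -> R) t du dv :
  is_derive u t du -> is_derive v t dv -> curve_derive (fun s => (u s, v s)) t (du, dv).
Proof.
intros Hu Hv.
change (@filterdiff R_AbsRing R_NormedModule C_R_NormedModule
  (fun s => (u s, v s)) (locally t) (fun y : R => (scal y du, scal y dv))).
apply (filterdiff_comp'_2 u v (fun x y => (x, y)) t
  (fun y : R => scal y du) (fun y : R => scal y dv) (fun x y => (x, y)) Hu Hv).
apply filterdiff_linear, is_linear_prod; [apply is_linear_fst | apply is_linear_snd].
Qed.

Notation continuous_curve h t := (@continuous R_UniformSpace C_UniformSpace h t).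

Lemma continuous_pair (u v : R -> R) t :
  continuous u t -> continuous v t -> continuous_curve (fun s => (u s, v s)) t.
Proof.
intros Hu Hv. apply (continuous_comp_2 u v (fun x y => (x, y)) t Hu Hv).
apply continuous_ext with (fun p => p). intros [x y]; reflexivity. apply continuous_id.
Qed.

Lemma continuous_Re (h : R -> C) t : continuous_curve h t -> continuous (fun s => Re (h s)) t.
Proof.
intros H. apply (continuous_comp h fst t H). destruct (h t) as [x y]. apply continuous_fst.
Qed.

Lemma continuous_Im (h : R -> C) t : continuous_curve h t -> continuous (fun s => Im (h s)) t.
Proof.
intros H. apply (continuous_comp h snd t H). destruct (h t) as [x y]. apply continuous_snd.
Qed.

Lemma continuous_Cplus (u v : R -> C) t :
  continuous_curve u t -> continuous_curve v t -> continuous_curve (fun s => u s + v s)%C t.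
Proof. exact (@continuous_plus R_UniformSpace R_AbsRing C_R_NormedModule u v t). Qed.

Lemma continuous_Cminus (u v : R -> C) t :
  continuous_curve u t -> continuous_curve v t -> continuous_curve (fun s => u s - v s)%C t.
Proof. exact (@continuous_minus R_UniformSpace R_AbsRing C_R_NormedModule u v t). Qed.

Lemma continuous_Cmult (u v : R -> C) t :
  continuous_curve u t -> continuous_curve v t -> continuous_curve (fun s => u s * v s)%C t.
Proof.
intros Hu Hv.
assert (A1 := continuous_Re _ _ Hu). assert (A2 := continuous_Im _ _ Hu).
assert (B1 := continuous_Re _ _ Hv). assert (B2 := continuous_Im _ _ Hv).
apply (continuous_pair (fun s => Re (u s) * Re (v s) - Im (u s) * Im (v s))
  (fun s => Re (u s) * Im (v s) + Im (u s) * Re (v s))).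
- apply (@continuous_minus R_UniformSpace R_AbsRing R_NormedModule);
  apply (@continuous_mult R_UniformSpace R_AbsRing); assumption.
- apply (@continuous_plus R_UniformSpace R_AbsRing R_NormedModule);
  apply (@continuous_mult R_UniformSpace R_AbsRing); assumption.
Qed.

Lemma continuous_Cmod (u : R -> C) t :
  continuous_curve u t -> continuous (fun s => Cmod (u s)) t.
Proof.
intros Hu.
apply (continuous_ext (fun s => @norm R_AbsRing C_R_NormedModule (u s))).
{ intros s. symmetry. apply Cmod_norm. }
apply continuous_comp. exact Hu. apply (@filterlim_norm R_AbsRing C_R_NormedModule).
Qed.

Lemma continuous_RtoC (u : R -> R) t : continuous u t -> continuous_curve (fun s => RtoC (u s)) t.
Proof. intros Hu. apply continuous_pair. exact Hu. apply continuous_const. Qed.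

Lemma continuous_expi (u : R -> R) t : continuous u t -> continuous_curve (fun s => expi (u s)) t.
Proof.
intros Hu. apply continuous_pair.
- apply (continuous_comp u cos). exact Hu. apply continuous_cos.
- apply (continuous_comp u sin). exact Hu. apply continuous_sin.
Qed.

Lemma continuous_affine (u : R -> C) (a b : R) t :
  (forall s, continuous_curve u s) -> continuous_curve (fun s => u (a * s + b)) t.
Proof.
intros H. apply (continuous_comp (fun s => a * s + b) u). 2: apply H.
apply (ex_derive_continuous (fun s => a * s + b)). auto_derive. trivial.
Qed.

Lemma continuous_neg (u : R -> C) t :
  (forall s, continuous_curve u s) -> continuous_curve (fun s => u (- s)) t.
Proof.
intros H. apply continuous_ext with (fun s => u (-1 * s + 0)). intros s; f_equal; ring.
apply continuous_affine, H.
Qed.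

Lemma continuous_bounded (u : R -> C) a b : a <= b ->
  (forall t, a <= t <= b -> continuous_curve u t) ->
  exists K, forall t, a <= t <= b -> Cmod (u t) <= K.
Proof.
intros Hab H.
destruct (continuity_ab_maj (fun t => Cmod (u t)) a b Hab) as [m [Hm _]].
- intros t Ht. apply continuity_pt_filterlim. apply continuous_Cmod, H, Ht.
- exists (Cmod (u m)). exact Hm.
Qed.

(** An estimate by a curve that tends to 0 at the left end of an interval; this
    is how an initial value on an edge of the cut is used, where the equations
    themselves are not available. *)
Lemma right_limit_zero (u : R -> C) a b K (v : C) : a < b ->
  continuous_curve u a -> u a = RtoC 0 ->
  (forall t, a < t < b -> Cmod v <= Cmod (u t) * K) -> v = RtoC 0.
Proof.
intros Hab Hu Ha H. apply Cmod_eq_0. apply Rle_antisym. 2: apply Cmod_ge_0.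
assert (Hc : continuous (fun t => Cmod (u t) * K) a).
{ apply (@continuous_mult R_UniformSpace R_AbsRing). apply continuous_Cmod, Hu. apply continuous_const. }
apply (@filterlim_le R (at_right a) _ (fun _ => Cmod v) (fun t => Cmod (u t) * K) (Cmod v) 0).
- assert (Hb : 0 < b - a) by lra. exists (mkposreal _ Hb). intros t Ht Hlt. apply H.
  apply Rabs_def2 in Ht. unfold minus, plus, opp in Ht; simpl in Ht. lra.
- apply filterlim_const.
- unfold continuous in Hc. rewrite Ha, Cmod_0, Rmult_0_l in Hc.
  eapply filterlim_filter_le_1. 2: exact Hc. apply filter_le_within.
Qed.

Lemma left_limit_eq (u v : R -> C) a b : a < b ->
  continuous_curve u b -> continuous_curve v b ->
  (forall t, a < t < b -> u t = v t) -> u b = v b.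
Proof.
intros Hab Hu Hv H.
apply (@filterlim_locally_unique R R_AbsRing C_R_NormedModule (at_left b) _ u).
- eapply filterlim_filter_le_1. 2: exact Hu. apply filter_le_within.
- apply filterlim_ext_loc with v.
  + assert (Hb : 0 < b - a) by lra. exists (mkposreal _ Hb). intros t Ht Hlt. symmetry. apply H.
    apply Rabs_def2 in Ht. unfold minus, plus, opp in Ht; simpl in Ht. lra.
  + eapply filterlim_filter_le_1. 2: exact Hv. apply filter_le_within.
Qed.

Lemma curve_derive_continuous (h : R -> C) t d : curve_derive h t d -> continuous_curve h t.
Proof. intros H. apply (@ex_derive_continuous R_AbsRing C_R_NormedModule). exists d. exact H. Qed.

(** Clamping the argument to [-h, h] turns the one-sided limits at the ends into
    continuity on the whole line. *)
Lemma continuous_extension (phi : R -> R) (h : R) : 0 < h ->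
  (forall t, - h < t < h -> continuous phi t) ->
  filterlim phi (at_left h) (locally (phi h)) ->
  filterlim phi (at_right (- h)) (locally (phi (- h))) ->
  exists psi : R -> R, (forall t, continuous psi t) /\
    forall t, - h <= t <= h -> psi t = phi t.
Proof.
intros Hh Hc Hl Hr.
set (psi := fun t => phi (Rmax (- h) (Rmin t h))).
assert (E : forall t, - h <= t <= h -> psi t = phi t).
{ intros t Ht. unfold psi. rewrite Rmin_left, Rmax_right by lra. reflexivity. }
assert (Eu : forall t, h <= t -> psi t = phi h).
{ intros t Ht. unfold psi. rewrite Rmin_right, Rmax_right by lra. reflexivity. }
assert (El : forall t, t <= - h -> psi t = phi (- h)).
{ intros t Ht. unfold psi. rewrite Rmin_left, Rmax_left by lra. reflexivity. }
exists psi. split; [| exact E]. intros t.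
destruct (Rtotal_order t (- h)) as [Ht | [Ht | Ht]].
- apply continuous_ext_loc with (fun _ => phi (- h)). 2: apply continuous_const.
  apply filter_imp with (fun s => s < - h). intros s Hs. symmetry. apply El. lra.
  apply open_lt, Ht.
- subst t. intros P HP. rewrite E in HP by lra.
  assert (L : locally (- h) (fun s => - h < s -> P (phi s))) by exact (Hr P HP).
  assert (L2 : locally (- h) (fun s => s < h)) by (apply open_lt; lra).
  change (locally (- h) (fun s => P (psi s))).
  generalize (filter_and _ _ L L2). apply filter_imp. intros s [K Ks].
  destruct (Rlt_dec (- h) s) as [Hs | Hs].
  + rewrite E by lra. exact (K Hs).
  + rewrite El by lra. exact (locally_singleton _ _ HP).
- destruct (Rtotal_order t h) as [Ht' | [Ht' | Ht']].
  + apply continuous_ext_loc with phi. 2: apply Hc; lra.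
    apply filter_imp with (fun s => - h < s /\ s < h). intros s Hs. symmetry. apply E. lra.
    apply filter_and. apply open_gt, Ht. apply open_lt, Ht'.
  + subst t. intros P HP. rewrite E in HP by lra.
    assert (L : locally h (fun s => s < h -> P (phi s))) by exact (Hl P HP).
    assert (L2 : locally h (fun s => - h < s)) by (apply open_gt; lra).
    change (locally h (fun s => P (psi s))).
  generalize (filter_and _ _ L L2). apply filter_imp. intros s [K Ks].
    destruct (Rlt_dec s h) as [Hs | Hs].
    * rewrite E by lra. exact (K Hs).
    * rewrite Eu by lra. exact (locally_singleton _ _ HP).
  + apply continuous_ext_loc with (fun _ => phi h). 2: apply continuous_const.
    apply filter_imp with (fun s => h < s). intros s Hs. symmetry. apply Eu. lra.
    apply open_gt, Ht'.
Qed.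

Lemma expi_plus a b : expi (a + b) = (expi a * expi b)%C.
Proof. unfold expi. rewrite cos_plus, sin_plus. apply injective_projections; simpl; ring. Qed.

Lemma expi_0 : expi 0 = RtoC 1.
Proof. unfold expi. rewrite cos_0, sin_0. reflexivity. Qed.

Lemma Cmod_expi a : Cmod (expi a) = 1.
Proof.
unfold Cmod, expi. rewrite <- sqrt_1 at 1. f_equal. simpl.
assert (H := sin2_cos2 a). unfold Rsqr in H. lra.
Qed.

Lemma expi_neq_0 a : expi a <> RtoC 0.
Proof. apply Cmod_gt_0. rewrite Cmod_expi. lra. Qed.

Lemma expi_opp a : expi (- a) = (/ expi a)%C.
Proof.
assert (H : (expi a * expi (- a))%C = RtoC 1).
{ rewrite <- expi_plus, Rplus_opp_r. apply expi_0. }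
assert (N := expi_neq_0 a).
replace (expi (- a)) with (/ expi a * (expi a * expi (- a)))%C by (field; exact N).
rewrite H. ring.
Qed.

Lemma expi_2PI_minus s : expi (s - 2 * PI) = expi s.
Proof.
unfold expi. rewrite <- (cos_period (s - 2 * PI) 1), <- (sin_period (s - 2 * PI) 1).
replace (s - 2 * PI + 2 * INR 1 * PI) with s by (simpl; ring). reflexivity.
Qed.

Lemma expi_derive s : curve_derive expi s (Ci * expi s)%C.
Proof.
replace (Ci * expi s)%C with (- sin s, cos s).
- apply (curve_derive_pair cos sin); [apply is_derive_cos | apply is_derive_sin].
- unfold expi. apply injective_projections; simpl; ring.
Qed.

Lemma expi_punctured_circle a : - PI < a < PI -> punctured_circle (expi a).
Proof.
intros Ha. split. apply Cmod_expi. intros E.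
assert (E' : cos a = -1) by exact (f_equal fst E).
replace a with (2 * (a / 2)) in E' by field. rewrite cos_2a_cos in E'.
assert (0 < cos (a / 2)) by (apply cos_gt_0; lra). nra.
Qed.

Lemma punctured_circle_1 : punctured_circle (RtoC 1).
Proof. rewrite <- expi_0. apply expi_punctured_circle. assert (H := PI_RGT_0). lra. Qed.

(** * Vanishing of solutions of linear equations *)

(** Multiplying |h|^2 by exp (- 2 M t) gives a function of t whose derivative,
    2 (Re k - M) |h|^2 exp (- 2 M t), is nonpositive.  Every uniqueness argument
    below reduces to this estimate for h' = k h. *)
Lemma gronwall (h k : R -> C) (a b M : R) : a <= b ->
  (forall t, a <= t <= b -> curve_derive h t (k t * h t)%C /\ Cmod (k t) <= M) ->
  Cmod (h b) <= Cmod (h a) * exp (M * (b - a)).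
Proof.
intros Hab H.
set (N := fun t => (Re (h t) ^ 2 + Im (h t) ^ 2) * exp (- (2 * M * t))).
assert (HN : forall t, N t = (Cmod (h t) * exp (- (M * t))) ^ 2).
{ intros t. unfold N. rewrite <- Cmod2_alt.
  replace (- (2 * M * t)) with (- (M * t) + - (M * t)) by ring. rewrite exp_plus. ring. }
assert (Hd : forall t, a <= t <= b -> is_derive N t
   (2 * (Re (k t) - M) * (Re (h t) ^ 2 + Im (h t) ^ 2) * exp (- (2 * M * t)))).
{ intros t Ht. destruct (H t Ht) as [H1 _].
  assert (HR := curve_derive_Re _ _ _ H1). assert (HI := curve_derive_Im _ _ _ H1).
  assert (key : forall (u v : R -> R) (du dv : R), is_derive u t du -> is_derive v t dv ->
    is_derive (fun t => (u t ^ 2 + v t ^ 2) * exp (- (2 * M * t))) t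
      (2 * (u t * du + v t * dv - M * (u t ^ 2 + v t ^ 2)) * exp (- (2 * M * t)))).
  { intros u v du dv Hu Hv. auto_derive.
    - split; [eexists; exact Hu |]. split; [eexists; exact Hv | exact I].
    - replace (Derive (fun x : R => u x) t) with du by (symmetry; exact (is_derive_unique u t du Hu)).
      replace (Derive (fun x : R => v x) t) with dv by (symmetry; exact (is_derive_unique v t dv Hv)).
      ring. }
  assert (E := key _ _ _ _ HR HI). unfold N.
  replace (2 * (Re (k t) - M) * (Re (h t) ^ 2 + Im (h t) ^ 2) * exp (- (2 * M * t)))
    with (2 * (Re (h t) * Re (k t * h t)%C + Im (h t) * Im (k t * h t)%C
       - M * (Re (h t) ^ 2 + Im (h t) ^ 2)) * exp (- (2 * M * t))).
  exact E.
  destruct (k t) as [k1 k2]; destruct (h t) as [h1 h2]; simpl. ring. }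
destruct (MVT_gen N a b (fun t =>
  2 * (Re (k t) - M) * (Re (h t) ^ 2 + Im (h t) ^ 2) * exp (- (2 * M * t)))) as [c [Hc E]].
- rewrite Rmin_left, Rmax_right by exact Hab. intros t Ht. apply Hd. lra.
- rewrite Rmin_left, Rmax_right by exact Hab. intros t Ht.
  apply continuity_pt_filterlim. apply (ex_derive_continuous N t).
  eexists. apply Hd. exact Ht.
- rewrite Rmin_left, Rmax_right in Hc by exact Hab.
  assert (Hle : N b <= N a).
  { destruct (H c Hc) as [_ Hk].
    assert (Re (k c) <= M).
    { assert (T := re_le_Cmod (k c)).
      eapply Rle_trans; [apply Rle_abs|]. lra. }
    assert (0 < exp (- (2 * M * c))) by apply exp_pos.
    assert (0 <= (Re (h c) ^ 2 + Im (h c) ^ 2) * exp (- (2 * M * c)) * (b - a)).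
    { apply Rmult_le_pos; [| lra]. apply Rmult_le_pos; [| lra]. nra. }
    nra. }
  rewrite !HN in Hle.
  assert (Hp : Cmod (h b) * exp (- (M * b)) <= Cmod (h a) * exp (- (M * a))).
  { apply Rsqr_incr_0; unfold Rsqr.
    - simpl in Hle. lra.
    - apply Rmult_le_pos. apply Cmod_ge_0. apply Rlt_le, exp_pos.
    - apply Rmult_le_pos. apply Cmod_ge_0. apply Rlt_le, exp_pos. }
  apply Rmult_le_reg_r with (exp (- (M * b))). apply exp_pos.
  rewrite Rmult_assoc, <- exp_plus.
  replace (M * (b - a) + - (M * b)) with (- (M * a)) by ring. exact Hp.
Qed.

Lemma hol_locally_bounded (c : C -> C) z d : hol c z d ->
  @locally C_UniformSpace z (fun w => Cmod (c w) <= Cmod (c z) + 1).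
Proof.
intros H.
assert (Hc : @continuous (AbsRing_UniformSpace C_AbsRing) C_UniformSpace c z).
{ apply (@ex_derive_continuous C_AbsRing C_NormedModule). exists d. exact H. }
rewrite locally_C. apply (Hc (fun v => Cmod v <= Cmod (c z) + 1)).
apply (locally_Cmod (c z)). exists 1. split; [lra|]. intros v Hv.
assert (T := Cmod_triangle (v - c z) (c z)).
replace (v - c z + c z)%C with v in T by ring. lra.
Qed.

Lemma segment_derive (z v : C) t :
  curve_derive (fun s : R => z + RtoC s * v)%C t v.
Proof.
destruct z as [z1 z2]; destruct v as [v1 v2].
apply is_derive_ext with (fun s : R => (z1 + s * v1, z2 + s * v2)).
{ intros s. apply injective_projections; simpl; ring. }
apply curve_derive_pair; auto_derive; trivial; ring.
Qed.

(** On a small disc c is bounded, and Gronwall's estimate on the segment from the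
    centre to any point of the disc starts with the value 0. *)
Lemma zero_locally_propagates (f c : C -> C) (z0 : C) :
  @locally C_UniformSpace z0 (fun z => hol f z (c z * f z)%C) ->
  @ex_derive C_AbsRing C_NormedModule c z0 ->
  f z0 = RtoC 0 -> @locally C_UniformSpace z0 (fun z => f z = RtoC 0).
Proof.
intros Hf [dc Hc] H0.
assert (L := filter_and _ _ Hf (hol_locally_bounded _ _ _ Hc)).
apply locally_Cmod in L. destruct L as [r [Hr L]].
apply locally_Cmod. exists r. split; [exact Hr|]. intros w Hw.
set (gam := fun s : R => (z0 + RtoC s * (w - z0))%C).
assert (Hin : forall t, 0 <= t <= 1 -> Cmod (gam t - z0) < r).
{ intros t Ht. unfold gam. replace (z0 + RtoC t * (w - z0) - z0)%C with (RtoC t * (w - z0))%C by ring.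
  rewrite Cmod_mult, Cmod_R, Rabs_pos_eq by lra. assert (T := Cmod_ge_0 (w - z0)). nra. }
assert (G : Cmod (f (gam 1)) <= Cmod (f (gam 0)) * exp (r * (Cmod (c z0) + 1) * (1 - 0))).
{ apply (gronwall (fun s => f (gam s)) (fun s => (w - z0) * c (gam s))%C). lra.
  intros t Ht. destruct (L _ (Hin t Ht)) as [L1 L2]. split.
  - replace ((w - z0) * c (gam t) * f (gam t))%C with ((w - z0) * (c (gam t) * f (gam t)))%C by ring.
    apply curve_comp. exact L1. apply segment_derive.
  - rewrite Cmod_mult. apply Rmult_le_compat; try apply Cmod_ge_0; lra. }
unfold gam in G.
replace (z0 + RtoC 1 * (w - z0))%C with w in G by ring.
replace (z0 + RtoC 0 * (w - z0))%C with z0 in G by ring.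
rewrite H0, Cmod_0, Rmult_0_l in G.
apply Cmod_eq_0. apply Rle_antisym. exact G. apply Cmod_ge_0.
Qed.

(** The zeros of a solution of f' = c f form an open set by local
    uniqueness, and the other points of U form an open set by continuity;
    connectedness leaves only one of them. *)
Lemma zero_propagates (U : C -> Prop) (f c : C -> C) (z0 : C) :
  @open C_UniformSpace U -> connected U ->
  (forall z, U z -> hol f z (c z * f z)%C) ->
  (forall z, U z -> @ex_derive C_AbsRing C_NormedModule c z) ->
  U z0 -> f z0 = RtoC 0 -> forall z, U z -> f z = RtoC 0.
Proof.
intros oU cU Hf Hc U0 F0 z Uz.
refine (proj2 (cU (fun w => U w /\ f w = RtoC 0) (fun w => U w /\ f w <> RtoC 0) _ _ _ _ _ z Uz)).
- intros w [Uw Fw]. apply filter_and. exact (oU w Uw).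
  apply zero_locally_propagates with c; auto.
  apply filter_imp with (2 := oU w Uw). exact Hf.
- intros w [Uw Fw]. apply filter_and. exact (oU w Uw).
  assert (Hw : @continuous (AbsRing_UniformSpace C_AbsRing) C_UniformSpace f w).
  { apply (@ex_derive_continuous C_AbsRing C_NormedModule). eexists. apply Hf, Uw. }
  rewrite locally_C. apply (Hw (fun v => v <> RtoC 0)).
  apply (locally_Cmod (f w)). exists (Cmod (f w)). split. apply Cmod_gt_0, Fw.
  intros v Hv E. rewrite E in Hv. replace (RtoC 0 - f w)%C with (- f w)%C in Hv by ring.
  rewrite Cmod_opp in Hv. lra.
- intros w Uw. destruct (Ceq_dec (f w) (RtoC 0)); [left | right]; split; assumption.
- intros w _ [_ E] [_ N]. contradiction.
- exists z0. auto.
Qed.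

(** * The linear system behind the Riccati equation *)

Definition coef_q (l mu : R) (z : C) : C := (l / z + mu * (1 + / (z * z)))%C.

(** If x and y solve this system, the quotient x / y solves the Riccati
    equation where y does not vanish; conversely x = (Psi Phi)^(1/2) and y = (Psi / Phi)^(1/2). *)
Definition linear_system (l mu om : R) (x y : C -> C) (z : C) : Prop :=
  hol x z (y z / (2 * Ci * om * z) + coef_q l mu z / 2 * x z)%C /\
  hol y z (x z / (2 * Ci * om * z) - coef_q l mu z / 2 * y z)%C.

Lemma coef_q_holomorphic l mu (z : C) : z <> RtoC 0 ->
  @ex_derive C_AbsRing C_NormedModule (fun w => coef_q l mu w / 2)%C z.
Proof.
intros Nz. eexists. apply hol_mult; [| apply hol_const]. apply hol_plus.
- apply hol_mult. apply hol_const. apply hol_inv, Nz.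
- apply hol_mult. apply hol_const. apply hol_plus. apply hol_const.
  apply hol_comp. apply hol_inv, Cmult_neq_0; exact Nz.
  apply hol_mult; apply hol_id.
Qed.

Lemma riccati_quotient_holomorphic l mu om G (z : C) : om <> 0 -> z <> RtoC 0 ->
  riccati_at l mu om G z ->
  @ex_derive C_AbsRing C_NormedModule (fun w => G w / (2 * Ci * om * w))%C z.
Proof.
intros Hom Nz HG. assert (N := RtoC_neq_0 _ Hom).
eexists. apply hol_mult. exact HG. apply hol_comp.
- apply hol_inv. repeat apply Cmult_neq_0; try assumption. apply two_neq_0. apply Ci_nz.
- apply hol_mult. apply hol_const. apply hol_id.
Qed.

Lemma linear_system_ext l mu om x y x' y' (z : C) :
  (forall w, x w = x' w) -> (forall w, y w = y' w) ->
  linear_system l mu om x y z -> linear_system l mu om x' y' z.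
Proof.
intros Ex Ey [Hx Hy]. split.
- rewrite <- Ex, <- Ey. exact (is_derive_ext _ _ _ _ Ex Hx).
- rewrite <- Ex, <- Ey. exact (is_derive_ext _ _ _ _ Ey Hy).
Qed.

Lemma linear_system_combination l mu om x y x' y' (a b : C) (z : C) :
  linear_system l mu om x y z -> linear_system l mu om x' y' z ->
  linear_system l mu om (fun w => a * x w + b * x' w)%C
    (fun w => a * y w + b * y' w)%C z.
Proof.
intros [Hx Hy] [Hx' Hy']. split.
- refine (hol_eq _ _ _ _ (hol_plus _ _ _ _ _
    (hol_mult _ _ _ _ _ (hol_const a z) Hx) (hol_mult _ _ _ _ _ (hol_const b z) Hx')) _).
  unfold Cdiv. ring.
- refine (hol_eq _ _ _ _ (hol_plus _ _ _ _ _
    (hol_mult _ _ _ _ _ (hol_const a z) Hy) (hol_mult _ _ _ _ _ (hol_const b z) Hy')) _).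
  unfold Cdiv. ring.
Qed.

(** The symmetry z -> 1/z of the equation, due to coef_q (1/z) = z^2 coef_q z.
    It provides the second solution, through which the monodromy is expressed. *)
Lemma linear_system_reflect l mu om x y (z : C) : om <> 0 -> z <> RtoC 0 ->
  linear_system l mu om x y (/ z)%C ->
  linear_system l mu om (fun w => y (/ w))%C (fun w => - x (/ w))%C z.
Proof.
intros Hom Hz [Hx Hy].
assert (N := RtoC_neq_0 _ Hom). assert (N2 := two_neq_0). assert (Ni := Ci_nz).
assert (Hi := hol_inv z Hz).
split.
- refine (hol_eq _ _ _ _ (hol_comp _ _ _ _ _ Hy Hi) _).
  unfold coef_q. field. repeat split; assumption.
- refine (hol_eq _ _ _ _ (hol_opp _ _ _ (hol_comp _ _ _ _ _ Hx Hi)) _).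
  unfold coef_q. field. repeat split; assumption.
Qed.

(** The matrix of the system is traceless. *)
Lemma linear_system_wronskian l mu om x y x' y' (z : C) :
  linear_system l mu om x y z -> linear_system l mu om x' y' z ->
  hol (fun w => x w * y' w - y w * x' w)%C z (RtoC 0).
Proof.
intros [Hx Hy] [Hx' Hy']. refine (hol_eq _ _ _ _ (hol_minus _ _ _ _ _
  (hol_mult _ _ _ _ _ Hx Hy') (hol_mult _ _ _ _ _ Hy Hx')) _).
unfold Cdiv. ring.
Qed.

(** The defect G d - n measures how far n / d is from G without dividing by d.
    It obeys a homogeneous linear equation, so that it vanishes as soon as it
    vanishes somewhere, whether or not d has zeros. *)
Lemma riccati_defect l mu om G n d (z : C) : om <> 0 -> z <> RtoC 0 ->
  riccati_at l mu om G z -> linear_system l mu om n d z ->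
  hol (fun w => G w * d w - n w)%C z
    ((coef_q l mu z / 2 - G z / (2 * Ci * om * z)) * (G z * d z - n z))%C.
Proof.
intros Hom Hz HG [Hn Hd].
assert (N := RtoC_neq_0 _ Hom). assert (N2 := two_neq_0). assert (Ni := Ci_nz).
refine (hol_eq _ _ _ _ (hol_minus _ _ _ _ _ (hol_mult _ _ _ _ _ HG Hd) Hn) _).
unfold riccati_rhs, coef_q. field. repeat split; assumption.
Qed.

(** The quadratic terms factor: G^2 - H^2 = (G + H)(G - H). *)
Lemma riccati_difference l mu om G H (z : C) : om <> 0 -> z <> RtoC 0 ->
  riccati_at l mu om G z -> riccati_at l mu om H z ->
  hol (fun w => G w - H w)%C z
    ((coef_q l mu z - (G z + H z) / (2 * Ci * om * z)) * (G z - H z))%C.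
Proof.
intros Hom Hz HG HH.
assert (N := RtoC_neq_0 _ Hom). assert (N2 := two_neq_0). assert (Ni := Ci_nz).
refine (hol_eq _ _ _ _ (hol_minus _ _ _ _ _ HG HH) _).
unfold riccati_rhs, coef_q. field. repeat split; assumption.
Qed.

(** Half the logarithmic derivatives of Psi and Phi add up to that of x and
    subtract to that of y, which turns the nonlinear pair of equations into the
    linear system. *)
Lemma linear_system_of_riccati l mu om Phi Psi s r (z dPsi : C) :
  om <> 0 -> z <> RtoC 0 -> riccati_at l mu om Phi z -> Phi z <> RtoC 0 ->
  hol Psi z dPsi -> (2 * Ci * om * z * dPsi = (Phi z + / Phi z) * Psi z)%C ->
  Psi z <> RtoC 0 ->
  @ex_derive C_AbsRing C_NormedModule s z ->
  @ex_derive C_AbsRing C_NormedModule r z ->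
  @locally C_UniformSpace z (fun w => s w * s w = Psi w)%C ->
  @locally C_UniformSpace z (fun w => r w * r w = Phi w)%C ->
  linear_system l mu om (fun w => s w * r w)%C (fun w => s w * / r w)%C z.
Proof.
intros Hom Hz HPhi NPhi HPsi EPsi NPsi Hs Hr Es Er.
assert (N := RtoC_neq_0 _ Hom). assert (N2 := two_neq_0). assert (Ni := Ci_nz).
assert (Es0 := locally_singleton _ _ Es). assert (Er0 := locally_singleton _ _ Er).
simpl in Es0, Er0.
assert (Ns : s z <> RtoC 0). { intros E. apply NPsi. rewrite <- Es0, E. ring. }
assert (Nr : r z <> RtoC 0). { intros E. apply NPhi. rewrite <- Er0, E. ring. }
assert (Ds := hol_sqrt _ _ _ _ Hs Es Ns HPsi).
assert (Dr := hol_sqrt _ _ _ _ Hr Er Nr HPhi).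
assert (EdPsi : dPsi = ((Phi z + / Phi z) * Psi z / (2 * Ci * om * z))%C).
{ rewrite <- EPsi. field. repeat split; assumption. }
unfold riccati_rhs in Dr. rewrite EdPsi in Ds. rewrite <- Er0 in Ds, Dr. rewrite <- Es0 in Ds.
split.
- refine (hol_eq _ _ _ _ (hol_mult _ _ _ _ _ Ds Dr) _).
  unfold coef_q. field. repeat split; assumption.
- refine (hol_eq _ _ _ _ (hol_mult _ _ _ _ _ Ds (hol_comp _ _ _ _ _ (hol_inv _ Nr) Dr)) _).
  unfold coef_q. field. repeat split; assumption.
Qed.

(** * Continuation along the unit circle *)

(** The germs of an analytic continuation are read off along the circle as a
    single curve g; near every time s it is the restriction of a holomorphic
    solution F s, and all derivatives of g are computed from that solution. *)
Definition follows (l mu om : R) (F : R -> C -> C) (g : R -> C) (s : R) : Prop :=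
  riccati_at l mu om (F s) (expi s) /\ locally s (fun s' => g s' = F s (expi s')).

(** The time is clamped to [a, b] in the choice of the germ, but not in the point
    where the germ is evaluated: g is then defined and differentiable on both
    sides of the end points as well. *)
Lemma riccati_continuation_curve l mu om gam a b f h :
  a < b -> (forall s, gam s = expi s) ->
  riccati_continuation l mu om gam a b f h ->
  exists (F : R -> C -> C) (g : R -> C),
    (forall s, a <= s <= b -> follows l mu om F g s) /\
    g a = f (expi a) /\ g b = h (expi b).
Proof.
intros Hab Eg [F [H1 [H2 [H3 H4]]]].
set (cl := fun s => Rmax a (Rmin s b)).
assert (Hcl : forall s, a <= s <= b -> cl s = s).
{ intros s Hs. unfold cl. rewrite Rmin_left, Rmax_right; lra. }
exists F, (fun s => F (cl s) (expi s)). split; [| split].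
- intros s Hs. split.
  + rewrite <- Eg. apply (locally_singleton _ _ (H1 s Hs)).
  + assert (T := H2 s Hs).
    assert (L : locally s (fun s' => (s' < a -> s = a) /\ (b < s' -> s = b))).
    { apply filter_and.
      - destruct (Req_dec s a) as [->|N]. apply filter_forall; tauto.
        apply filter_imp with (fun s' => a < s'). intros; lra.
        apply open_gt. lra.
      - destruct (Req_dec s b) as [->|N]. apply filter_forall; tauto.
        apply filter_imp with (fun s' => s' < b). intros; lra.
        apply open_lt. lra. }
    generalize (filter_and _ _ T L). apply filter_imp. intros s' [K [La Lb]].
    destruct (Rlt_dec s' a) as [Ha|Ha].
    { rewrite (La Ha). unfold cl. rewrite Rmin_left, Rmax_left; [reflexivity | lra | lra]. }
    destruct (Rlt_dec b s') as [Hb|Hb].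
    { rewrite (Lb Hb). unfold cl. rewrite Rmin_right, Rmax_right; [reflexivity | lra | lra]. }
    rewrite Hcl by lra. rewrite <- Eg.
    exact (locally_singleton _ _ (K (conj (Rnot_lt_le _ _ Ha) (Rnot_lt_le _ _ Hb)))).
- rewrite Hcl by lra. rewrite <- Eg. exact (locally_singleton _ _ H3).
- rewrite Hcl by lra. rewrite <- Eg. exact (locally_singleton _ _ H4).
Qed.

Lemma curve_along_circle (f : C -> C) (h : R -> C) (k : C) s :
  locally s (fun s' => h s' = f (expi s')) -> hol f (expi s) (k * f (expi s))%C ->
  curve_derive h s (Ci * expi s * k * h s)%C.
Proof.
intros L Hf.
assert (E := locally_singleton _ _ L). simpl in E. rewrite E.
apply is_derive_ext_loc with (fun s' => f (expi s')).
{ revert L. apply filter_imp. intros s' Es. symmetry. exact Es. }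
replace (Ci * expi s * k * f (expi s))%C with ((Ci * expi s) * (k * f (expi s)))%C by ring.
apply curve_comp. exact Hf. apply expi_derive.
Qed.

Lemma follows_continuous l mu om F g s : follows l mu om F g s -> continuous_curve g s.
Proof.
intros [H L].
assert (D := curve_comp (F s) expi s _ _ H (expi_derive s)).
apply curve_derive_continuous with (1 := is_derive_ext_loc _ _ _ _
  (filter_imp _ _ (fun s' e => eq_sym e) L) D).
Qed.

(** A bound that is uniform on the circle, including near the cut, because
    z coef_q z = l + mu (z + 1/z) there.  The factor [al] is 1 in the equation of
    a difference of two solutions and 1/2 in that of a defect. *)
Lemma circle_coefficient_bound l mu om (al : R) (G : C) s : 0 < om -> 0 <= al <= 1 ->
  Cmod (Ci * expi s * (al * coef_q l mu (expi s) - G / (2 * Ci * om * expi s)))%C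
    <= Rabs l + 2 * Rabs mu + Cmod G / (2 * om).
Proof.
intros Hom Hal.
assert (N := RtoC_neq_0 om ltac:(lra)). assert (N2 := two_neq_0). assert (Ni := Ci_nz).
assert (Ne := expi_neq_0 s).
replace (Ci * expi s * (al * coef_q l mu (expi s) - G / (2 * Ci * om * expi s)))%C
  with ((Ci * al) * (l + mu * (expi s + expi (- s))) - G / (2 * om))%C.
2: { rewrite expi_opp. unfold coef_q. field. repeat split; assumption. }
assert (B1 : Cmod (l + mu * (expi s + expi (- s))) <= Rabs l + 2 * Rabs mu).
{ eapply Rle_trans; [apply Cmod_triangle |]. rewrite Cmod_mult, !Cmod_R.
  assert (T := Cmod_triangle (expi s) (expi (- s))). rewrite !Cmod_expi in T.
  assert (P := Rabs_pos mu). nra. }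
assert (B2 : Cmod (G / (2 * om)) = Cmod G / (2 * om)).
{ rewrite Cmod_div by (apply Cmult_neq_0; assumption).
  rewrite Cmod_mult, !Cmod_R, !Rabs_pos_eq; lra. }
unfold Cminus. eapply Rle_trans; [apply Cmod_triangle |].
rewrite Cmod_opp, B2. apply Rplus_le_compat_r.
rewrite !Cmod_mult, Cmod_Ci, Cmod_R, Rabs_pos_eq by lra.
assert (P := Cmod_ge_0 (l + mu * (expi s + expi (- s)))). nra.
Qed.

(** Before the continuation meets the cut, the continued solution and Phi start
    from the same value and obey the same equation. *)
Lemma continuation_stays_on_solution l mu om Phi F g b : 0 < om -> b <= PI ->
  (forall z, punctured_circle z -> riccati_at l mu om Phi z) ->
  (forall s, 0 <= s < b -> follows l mu om F g s) ->
  g 0 = Phi (RtoC 1) -> forall s, 0 <= s < b -> g s = Phi (expi s).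
Proof.
intros Hom Hb HPhi HF H0 s Hs.
assert (Hpc : forall t, 0 <= t <= s -> punctured_circle (expi t)).
{ intros t Ht. apply expi_punctured_circle. assert (Hpi := PI_RGT_0). lra. }
assert (Hc : forall t, 0 <= t <= s -> continuous_curve (fun t => g t + Phi (expi t))%C t).
{ intros t Ht. apply continuous_Cplus.
  - apply (follows_continuous l mu om F). apply HF. lra.
  - eapply curve_derive_continuous. apply curve_comp. apply HPhi, Hpc, Ht. apply expi_derive. }
destruct (continuous_bounded _ 0 s (proj1 Hs) Hc) as [K HK].
assert (G := gronwall (fun t => g t - Phi (expi t))%C
  (fun t => Ci * expi t * (RtoC 1 * coef_q l mu (expi t)
    - (g t + Phi (expi t)) / (2 * Ci * om * expi t)))%C
  0 s (Rabs l + 2 * Rabs mu + K / (2 * om)) (proj1 Hs)).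
simpl in G. rewrite H0, expi_0 in G.
replace (Phi (RtoC 1) - Phi (RtoC 1))%C with (RtoC 0) in G by ring.
rewrite Cmod_0, Rmult_0_l in G.
assert (Z : (g s - Phi (expi s))%C = RtoC 0).
{ apply Cmod_eq_0, Rle_antisym; [apply G | apply Cmod_ge_0].
  intros t Ht. assert (Hft : follows l mu om F g t) by (apply HF; lra). split.
  - destruct Hft as [R1 L1]. assert (Eg := locally_singleton _ _ L1). simpl in Eg.
    apply curve_along_circle with (fun z => F t z - Phi z)%C.
    + revert L1. apply filter_imp. intros t' E. rewrite E. reflexivity.
    + rewrite Cmult_1_l, Eg. apply riccati_difference. lra. apply expi_neq_0. exact R1.
      apply HPhi, Hpc, Ht.
  - eapply Rle_trans. apply circle_coefficient_bound; lra.
    apply Rplus_le_compat_l. apply Rmult_le_compat_r.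
    apply Rlt_le, Rinv_0_lt_compat; lra. apply HK, Ht. }
replace (g s) with (g s - Phi (expi s) + Phi (expi s))%C by ring. rewrite Z. ring.
Qed.

(** * Solutions built from the branches of the square roots *)

Lemma monodromy_linear_system l mu om phi sPsi sPhi (z : C) : om <> 0 -> z <> RtoC 0 ->
  linear_system l mu om (fun w => sPsi w * sPhi w)%C (fun w => sPsi w * / sPhi w)%C z ->
  linear_system l mu om (fun w => sPsi w * sPhi w)%C (fun w => sPsi w * / sPhi w)%C (/ z)%C ->
  linear_system l mu om (monodromy_num om phi sPsi sPhi) (monodromy_den om phi sPsi sPhi) z.
Proof.
intros Hom Hz H1 H2.
refine (linear_system_ext _ _ _ _ _ _ _ _ _ _ (linear_system_combination _ _ _ _ _ _ _
  (coef_direct om phi) (coef_inverse om phi) _ H1 (linear_system_reflect _ _ _ _ _ _ Hom Hz H2))).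
- intros w. unfold monodromy_num. ring.
- intros w. unfold monodromy_den. ring.
Qed.

(** A zero of Psi would spread over the connected domain, up to the point 1. *)
Lemma psi_neq_0 om U Phi Psi : om <> 0 -> circle_vicinity U ->
  (forall z, U z -> @ex_derive C_AbsRing C_NormedModule Phi z) ->
  psi_solution om U Phi Psi -> Psi (RtoC 1) <> RtoC 0 ->
  forall z, U z -> Psi z <> RtoC 0.
Proof.
intros Hom [oU [cU [sU pU]]] HPhi HPsi N1 z Uz E. apply N1.
assert (N := RtoC_neq_0 _ Hom). assert (N2 := two_neq_0). assert (Ni := Ci_nz).
refine (zero_propagates U Psi
  (fun w => (Phi w + / Phi w) * (/ (2 * Ci * om) * / w))%C z oU cU _ _ Uz E _
  (pU _ punctured_circle_1)).
- intros w Uw. destruct (HPsi w Uw) as [NPhi [d [Hd Ed]]].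
  assert (Nw := slit_plane_neq_0 _ (sU w Uw)).
  refine (hol_eq _ _ _ _ Hd _).
  replace ((Phi w + / Phi w) * (/ (2 * Ci * om) * / w) * Psi w)%C
    with ((Phi w + / Phi w) * Psi w * / (2 * Ci * om * w))%C.
  2: { field. repeat split; assumption. }
  rewrite <- Ed. field. repeat split; assumption.
- intros w Uw. destruct (HPsi w Uw) as [NPhi _]. destruct (HPhi w Uw) as [d Hd].
  assert (Nw := slit_plane_neq_0 _ (sU w Uw)).
  eexists. apply hol_mult. apply hol_plus. exact Hd. apply hol_comp. apply hol_inv, NPhi. exact Hd.
  apply hol_mult. apply hol_const. apply hol_inv, Nw.
Qed.

Lemma branch_linear_system l mu om U Phi Psi sPsi sPhi w1 w2 :
  om <> 0 -> circle_vicinity U -> riccati_solution l mu om U Phi ->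
  psi_solution om U Phi Psi -> Psi (RtoC 1) = RtoC 1 ->
  is_sqrt_branch om U Psi w1 sPsi -> is_sqrt_branch om U Phi w2 sPhi ->
  forall z, U z ->
  linear_system l mu om (fun w => sPsi w * sPhi w)%C (fun w => sPsi w * / sPhi w)%C z.
Proof.
intros Hom HU HPhi HPsi HPsi1 [HsPsi _] [HsPhi _] z Uz.
assert (N1 : Psi (RtoC 1) <> RtoC 0). { rewrite HPsi1. apply RtoC_neq_0. lra. }
assert (NPsi : Psi z <> RtoC 0).
{ apply (psi_neq_0 om U Phi Psi); try assumption. intros w Uw. eexists. exact (HPhi w Uw). }
destruct HU as [oU [_ [sU _]]].
destruct (HPsi z Uz) as [NPhi [d [Hd Ed]]].
apply linear_system_of_riccati with Phi Psi d; auto.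
- apply slit_plane_neq_0; auto.
- apply (HsPsi z Uz).
- apply (HsPhi z Uz).
- generalize (oU z Uz). apply filter_imp. apply HsPsi.
- generalize (oU z Uz). apply filter_imp. apply HsPhi.
Qed.

(** * Values on the circle and on the edges of the cut *)

(** [circle_x] and [circle_y] are the values of (Psi Phi)^(1/2) and
    (Psi / Phi)^(1/2) at exp (i om t), in terms of the phase.  These expressions
    still make sense at t = T/2 and t = -T/2, on the edges of the cut. *)
Definition circle_x (phi : R -> R) (t : R) : C :=
  (RtoC (exp (phase_integral phi t / 2)) * expi (phi t / 2))%C.
Definition circle_y (phi : R -> R) (t : R) : C :=
  (RtoC (exp (phase_integral phi t / 2)) * expi (- (phi t / 2)))%C.
Definition circle_num (om : R) (phi : R -> R) (t : R) : C :=
  (coef_direct om phi * circle_x phi t + coef_inverse om phi * circle_y phi (- t))%C.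
Definition circle_den (om : R) (phi : R -> R) (t : R) : C :=
  (coef_direct om phi * circle_y phi t - coef_inverse om phi * circle_x phi (- t))%C.

Lemma half_period om : 0 < om -> om * (period om / 2) = PI.
Proof. intros H. unfold period. field. lra. Qed.

Lemma phase_integral_ext (phi psi : R -> R) h t :
  (forall s, - h <= s <= h -> psi s = phi s) -> - h <= t <= h -> 0 < h ->
  phase_integral psi t = phase_integral phi t.
Proof.
intros H Ht Hh. apply RInt_ext. intros s Hs. rewrite H. reflexivity.
destruct (Rle_dec 0 t).
- rewrite Rmin_left, Rmax_right in Hs; lra.
- rewrite Rmin_right, Rmax_left in Hs; lra.
Qed.

(** The initial condition.  Write alpha = phi(T/2)/2 and beta = phi(-T/2)/2, and
    drop the common factor exp ((P(T/2) + P(-T/2))/2).  Expressing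
    i sin(alpha - beta) by exponentials, the numerator at the lower edge becomes
    exp(i alpha) cos(alpha + beta) and the denominator
    exp(- i alpha) cos(alpha + beta). *)
Lemma circle_edge om phi : let h := period om / 2 in
  circle_num om phi (- h) = (expi (phi h) * circle_den om phi (- h))%C.
Proof.
intros h. unfold circle_num, circle_den, circle_x, circle_y, coef_direct, coef_inverse. fold h.
rewrite Ropp_involutive.
replace (/ 2 * phase_integral phi h) with (phase_integral phi h / 2) by (unfold Rdiv; ring).
replace (/ 2 * phase_integral phi (- h)) with (phase_integral phi (- h) / 2) by (unfold Rdiv; ring).
set (E := exp (phase_integral phi h / 2)). set (E' := exp (phase_integral phi (- h) / 2)).
replace (/ 2 * (phi h - phi (- h))) with (phi h / 2 - phi (- h) / 2) by field.
replace (phi h) with (2 * (phi h / 2)) at 1 4 by field.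
set (al := phi h / 2). set (be := phi (- h) / 2).
replace (phi h) with (2 * al) by (unfold al; field).
unfold expi. rewrite !cos_neg, !sin_neg, sin_minus, cos_2a, sin_2a.
assert (Ha := sin2_cos2 al). unfold Rsqr in Ha.
assert (Ha' : sin al * sin al = 1 - cos al * cos al) by lra.
apply injective_projections; simpl; ring [Ha'].
Qed.

Lemma monodromy_on_circle om U Phi Psi phi sPsi sPhi t :
  is_sqrt_branch om U Psi (fun t => RtoC (exp (phase_integral phi t / 2))) sPsi ->
  is_sqrt_branch om U Phi (fun t => expi (phi t / 2)) sPhi ->
  - (period om / 2) < t < period om / 2 ->
  monodromy_num om phi sPsi sPhi (expi (om * t)) = circle_num om phi t /\
  monodromy_den om phi sPsi sPhi (expi (om * t)) = circle_den om phi t.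
Proof.
intros [_ H1] [_ H2] Ht.
assert (H1' := H1 (- t) ltac:(lra)). assert (H2' := H2 (- t) ltac:(lra)).
specialize (H1 t Ht). specialize (H2 t Ht).
unfold monodromy_num, monodromy_den, circle_num, circle_den, circle_x, circle_y.
rewrite <- expi_opp. replace (- (om * t)) with (om * - t) by ring.
rewrite H1, H2, H1', H2', !expi_opp. split; ring.
Qed.

Lemma phase_integral_continuous (phi : R -> R) (t : R) : (forall s, continuous phi s) ->
  continuous (phase_integral phi) t.
Proof.
intros H. assert (Hc : forall s, continuous (fun tau => cos (phi tau)) s).
{ intros s. apply (continuous_comp phi cos). apply H. apply continuous_cos. }
apply (ex_derive_continuous (phase_integral phi)).
exists (cos (phi t)).
apply (@is_derive_RInt R_NormedModule (fun tau => cos (phi tau)) (phase_integral phi) 0 t).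
- apply filter_forall. intros s. apply (@RInt_correct R_CompleteNormedModule).
  apply (@ex_RInt_continuous R_CompleteNormedModule). intros; apply Hc.
- apply Hc.
Qed.

Lemma circle_x_continuous (phi : R -> R) (t : R) :
  (forall s, continuous phi s) -> continuous_curve (circle_x phi) t.
Proof.
intros H. apply continuous_Cmult.
- apply continuous_RtoC. apply (continuous_comp (fun t => phase_integral phi t / 2) exp).
  + apply (@continuous_mult R_UniformSpace R_AbsRing).
    apply phase_integral_continuous, H. apply continuous_const.
  + apply continuous_exp.
- apply continuous_expi. apply (@continuous_mult R_UniformSpace R_AbsRing). apply H. apply continuous_const.
Qed.

Lemma circle_y_continuous (phi : R -> R) (t : R) :
  (forall s, continuous phi s) -> continuous_curve (circle_y phi) t.
Proof.
intros H. apply continuous_Cmult.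
- apply continuous_RtoC. apply (continuous_comp (fun t => phase_integral phi t / 2) exp).
  + apply (@continuous_mult R_UniformSpace R_AbsRing).
    apply phase_integral_continuous, H. apply continuous_const.
  + apply continuous_exp.
- apply continuous_expi. apply (@continuous_opp R_UniformSpace R_AbsRing R_NormedModule).
  apply (@continuous_mult R_UniformSpace R_AbsRing). apply H. apply continuous_const.
Qed.

Lemma circle_num_continuous om (phi : R -> R) (t : R) :
  (forall s, continuous phi s) -> continuous_curve (circle_num om phi) t.
Proof.
intros H. apply continuous_Cplus; apply continuous_Cmult; try apply continuous_const.
apply circle_x_continuous, H. apply continuous_neg. intros s; apply circle_y_continuous, H.
Qed.

Lemma circle_den_continuous om (phi : R -> R) (t : R) :
  (forall s, continuous phi s) -> continuous_curve (circle_den om phi) t.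
Proof.
intros H. apply continuous_Cminus; apply continuous_Cmult; try apply continuous_const.
apply circle_y_continuous, H. apply continuous_neg. intros s; apply circle_x_continuous, H.
Qed.

(** The Wronskian of the solution (x(z), y(z)) and of the reflected
    solution (y(1/z), - x(1/z)) is constant on the circle; the two sides are its
    opposites at the edge of the cut and at the point 1. *)
Lemma circle_wronskian l mu om x y (phi : R -> R) : let h := period om / 2 in
  0 < om -> (forall t, continuous phi t) ->
  (forall z, punctured_circle z -> linear_system l mu om x y z) ->
  (forall t, - h < t < h -> x (expi (om * t)) = circle_x phi t /\ y (expi (om * t)) = circle_y phi t) ->
  (circle_x phi h * circle_x phi (- h) + circle_y phi h * circle_y phi (- h)
   = circle_x phi 0 * circle_x phi 0 + circle_y phi 0 * circle_y phi 0)%C.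
Proof.
intros h Hom Hphi Hsys Hval.
assert (Hpi := PI_RGT_0). assert (Hh := half_period om Hom). fold h in Hh.
assert (Hh0 : 0 < h) by nra.
apply (left_limit_eq (fun t => circle_x phi t * circle_x phi (- t) + circle_y phi t * circle_y phi (- t))%C
  (fun _ => circle_x phi 0 * circle_x phi 0 + circle_y phi 0 * circle_y phi 0)%C 0 h Hh0).
- apply continuous_Cplus; apply continuous_Cmult.
  + apply circle_x_continuous, Hphi.
  + apply continuous_neg. intros; apply circle_x_continuous, Hphi.
  + apply circle_y_continuous, Hphi.
  + apply continuous_neg. intros; apply circle_y_continuous, Hphi.
- apply continuous_const.
- intros t Ht. set (w := fun z => (x z * - x (/ z) - y z * y (/ z))%C).
  assert (Hw : forall t, - h < t < h -> w (expi (om * t)) =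
     (- (circle_x phi t * circle_x phi (- t) + circle_y phi t * circle_y phi (- t)))%C).
  { intros s Hs. destruct (Hval s Hs) as [E1 E2]. destruct (Hval (- s)) as [E3 E4]; [lra|].
    unfold w. rewrite <- expi_opp. replace (- (om * s)) with (om * - s) by ring.
    rewrite E1, E2, E3, E4. ring. }
  assert (Hpc : forall s, 0 <= s <= om * t -> punctured_circle (expi s) /\ punctured_circle (/ expi s)%C).
  { intros s Hs. assert (s < PI) by nra. rewrite <- expi_opp.
    split; apply expi_punctured_circle; lra. }
  assert (D : forall s, 0 <= s <= om * t -> hol w (expi s) (RtoC 0)).
  { intros s Hs. destruct (Hpc s Hs) as [P1 P2].
    apply linear_system_wronskian with l mu om. apply Hsys, P1.
    apply linear_system_reflect. lra. apply expi_neq_0. apply Hsys, P2. }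
  assert (G := gronwall (fun s => w (expi s) - w (RtoC 1))%C (fun _ => RtoC 0) 0 (om * t) 0 ltac:(nra)).
  cbv beta in G. rewrite expi_0 in G.
  replace (w (RtoC 1) - w (RtoC 1))%C with (RtoC 0) in G by ring.
  rewrite Cmod_0, Rmult_0_l in G.
  assert (Z : (w (expi (om * t)) - w (RtoC 1))%C = RtoC 0).
  { apply Cmod_eq_0, Rle_antisym; [apply G | apply Cmod_ge_0].
    intros s Hs. split. 2: apply Rle_refl.
    replace (RtoC 0 * (w (expi s) - w (RtoC 1)))%C with (Ci * expi s * (RtoC 0 - RtoC 0))%C by ring.
    apply (curve_comp (fun z => w z - w (RtoC 1))%C).
    apply hol_minus. apply D, Hs. apply hol_const. apply expi_derive. }
  assert (E0 := Hw 0 ltac:(lra)). rewrite Rmult_0_r, expi_0, Ropp_0 in E0.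
  rewrite E0, Hw in Z by lra.
  set (u := (circle_x phi t * circle_x phi (- t) + circle_y phi t * circle_y phi (- t))%C) in *.
  set (v := (circle_x phi 0 * circle_x phi 0 + circle_y phi 0 * circle_y phi 0)%C) in *.
  replace u with (v - (- u - - v))%C by ring. rewrite Z. ring.
Qed.

(** The numerator at 1 is A exp(i theta) + i B exp(- i theta), with theta =
    phi(0)/2 and A, B real; as a real linear system in A and B its determinant is
    cos(phi(0)).  If that is not 0 then A = B = 0, that is, cos(phi(T/2)) = 0 and
    sin((phi(T/2) - phi(-T/2))/2) = 0, whence cos((phi(T/2) + phi(-T/2))/2) = 0.
    This cosine is, up to a positive factor, the value of the Wronskian on the
    edge of the cut, and cos(phi(0)) its value at 1. *)
Lemma degenerate_coefficients om (phi : R -> R) : let h := period om / 2 in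
  (circle_x phi h * circle_x phi (- h) + circle_y phi h * circle_y phi (- h)
   = circle_x phi 0 * circle_x phi 0 + circle_y phi 0 * circle_y phi 0)%C ->
  circle_num om phi 0 = RtoC 0 -> cos (phi 0) = 0.
Proof.
intros h HW Hn.
assert (E0 : phase_integral phi 0 = 0) by apply (@RInt_point R_CompleteNormedModule).
assert (Hn' := f_equal fst Hn). assert (W := f_equal fst HW). assert (Hn'' := f_equal snd Hn).
clear HW Hn.
unfold circle_num, circle_x, circle_y, coef_direct, coef_inverse, expi in *.
rewrite ?Ropp_0, ?E0 in *. fold h in Hn', Hn''. simpl in Hn', Hn'', W.
replace (0 / 2) with 0 in * by field.
rewrite ?exp_0, ?cos_neg, ?sin_neg in *.
replace (cos (phi 0)) with (cos (phi 0 / 2) * cos (phi 0 / 2) - sin (phi 0 / 2) * sin (phi 0 / 2))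
  by (rewrite <- cos_2a; f_equal; field).
replace (exp (phase_integral phi h / 2)) with (exp (/ 2 * phase_integral phi h)) in W by (f_equal; field).
replace (exp (phase_integral phi (- h) / 2)) with (exp (/ 2 * phase_integral phi (- h))) in W by (f_equal; field).
set (c := cos (phi 0 / 2)) in *. set (s := sin (phi 0 / 2)) in *.
assert (P1 := exp_pos (/ 2 * phase_integral phi h)).
assert (P2 := exp_pos (/ 2 * phase_integral phi (- h))).
set (E := exp (/ 2 * phase_integral phi h)) in *.
set (E' := exp (/ 2 * phase_integral phi (- h))) in *.
destruct (Req_dec (c * c - s * s) 0) as [K | K]; [exact K |].
set (de := / 2 * (phi h - phi (- h))) in *.
assert (H1 : E * cos (phi h) * c + E' * sin de * s = 0) by lra.
assert (H2 : E * cos (phi h) * s + E' * sin de * c = 0) by lra.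
assert (A0 : E * cos (phi h) * (c * c - s * s) = 0).
{ transitivity (c * (E * cos (phi h) * c + E' * sin de * s)
    - s * (E * cos (phi h) * s + E' * sin de * c)).
  ring. rewrite H1, H2. ring. }
assert (B0 : E' * sin de * (c * c - s * s) = 0).
{ transitivity (c * (E * cos (phi h) * s + E' * sin de * c)
    - s * (E * cos (phi h) * c + E' * sin de * s)).
  ring. rewrite H1, H2. ring. }
assert (A1 : cos (phi h) = 0).
{ apply Rmult_integral in A0. destruct A0 as [A0 | A0]; [| contradiction].
  apply Rmult_integral in A0. destruct A0; [lra | assumption]. }
assert (B1 : sin de = 0).
{ apply Rmult_integral in B0. destruct B0 as [B0 | B0]; [| contradiction].
  apply Rmult_integral in B0. destruct B0; [lra | assumption]. }
assert (S : cos (phi h / 2) * cos (phi (- h) / 2) - sin (phi h / 2) * sin (phi (- h) / 2) = 0).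
{ rewrite <- cos_plus. replace (phi h / 2 + phi (- h) / 2) with (phi h - de) by (unfold de; field).
  rewrite cos_minus, A1, B1. ring. }
transitivity (E * E' * (cos (phi h / 2) * cos (phi (- h) / 2) - sin (phi h / 2) * sin (phi (- h) / 2))).
- lra.
- rewrite S. ring.
Qed.

Lemma expi_cos_0 a : cos a = 0 -> expi a = Ci \/ expi a = (- Ci)%C.
Proof.
intros H. assert (S := sin2_cos2 a). unfold Rsqr in S. rewrite H in S.
assert (T : (sin a - 1) * (sin a + 1) = 0) by lra.
apply Rmult_integral in T. destruct T as [T | T]; [left | right];
unfold expi; rewrite H; apply injective_projections; simpl; lra.
Qed.

(** * The monodromy formula *)

(** The continuation along the full circle starting at 1 follows Phi up to the
    upper edge of the cut, where it takes the value exp(i phi(T/2)).  On the second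
    half of the circle it is compared with num / den: as num = exp(i phi(T/2)) den on
    the lower edge, the defect tends to 0 at the cut, and Gronwall's estimate
    carries this to the end of the circle. *)
Lemma monodromy_at_1 l mu om Phi PhiM num den (phi : R -> R) :
  0 < om -> (forall t, continuous phi t) ->
  (forall z, punctured_circle z -> riccati_at l mu om Phi z) ->
  (forall z, punctured_circle z -> linear_system l mu om num den z) ->
  (forall t, - (period om / 2) < t < period om / 2 ->
     Phi (expi (om * t)) = expi (phi t) /\
     num (expi (om * t)) = circle_num om phi t /\ den (expi (om * t)) = circle_den om phi t) ->
  riccati_continuation l mu om (fun s => RtoC 1 * expi s)%C 0 (2 * PI) Phi PhiM ->
  (PhiM (RtoC 1) * den (RtoC 1) = num (RtoC 1))%C.
Proof.
intros Hom Hphi HPhi Hsys Hval Hcont.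
assert (Hpi := PI_RGT_0). assert (Hh := half_period om Hom). set (h := period om / 2) in *.
assert (Hh0 : 0 < h) by nra.
destruct (riccati_continuation_curve l mu om (fun s => RtoC 1 * expi s)%C 0 (2 * PI) Phi PhiM
  ltac:(lra) (fun s => Cmult_1_l (expi s)) Hcont) as [F [g [HF [g0 g2pi]]]].
rewrite expi_0 in g0.
assert (E2 : expi (2 * PI) = RtoC 1). { rewrite <- expi_2PI_minus, <- expi_0. f_equal; ring. }
rewrite E2 in g2pi.
assert (Hg := continuation_stays_on_solution l mu om Phi F g PI Hom (Rle_refl _) HPhi
  (fun s Hs => HF s ltac:(lra)) g0).
assert (gpi : g PI = expi (phi h)).
{ assert (Eh : PI / om = h). { rewrite <- Hh. field. lra. }
  rewrite <- Eh.
  apply (left_limit_eq g (fun s => expi (phi (s / om))) 0 PI Hpi).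
  - apply (follows_continuous l mu om F), HF. lra.
  - apply (continuous_ext (fun s => expi (phi (/ om * s + 0)))).
    { intros s. do 2 f_equal. unfold Rdiv. ring. }
    apply (continuous_affine (fun t => expi (phi t))). intros s. apply continuous_expi, Hphi.
  - intros t Ht. rewrite Hg by lra.
    replace t with (om * (t / om)) at 1 by (field; lra). apply Hval. split.
    + apply Rmult_lt_reg_l with om; [lra|]. replace (om * (t / om)) with t by (field; lra). lra.
    + apply Rmult_lt_reg_l with om; [lra|]. replace (om * (t / om)) with t by (field; lra). lra. }
assert (Hgc : forall s, 0 <= s <= 2 * PI -> continuous_curve g s).
{ intros s Hs. apply (follows_continuous l mu om F), HF, Hs. }
destruct (continuous_bounded g 0 (2 * PI) ltac:(lra) Hgc) as [K HK].
set (M := Rabs l + 2 * Rabs mu + K / (2 * om)).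
(* The defect along the second half of the circle, in terms of the phase, so that
   it is continuous up to the cut; om t = s - 2 PI is the angle seen from the
   other side of the cut. *)
set (H := fun s => (g s * circle_den om phi (/ om * s + - (2 * PI / om))
   - circle_num om phi (/ om * s + - (2 * PI / om)))%C).
assert (Hpc : forall s, PI < s <= 2 * PI -> punctured_circle (expi s)).
{ intros s Hs. rewrite <- expi_2PI_minus. apply expi_punctured_circle. lra. }
assert (Z : (g (2 * PI)%R * den (RtoC 1) - num (RtoC 1))%C = RtoC 0).
{ apply (right_limit_zero H PI (2 * PI) (exp (M * PI))).
  - lra.
  - apply continuous_Cminus. apply continuous_Cmult.
    + apply Hgc. lra.
    + apply (continuous_affine (circle_den om phi)). intros; apply circle_den_continuous, Hphi.
    + apply (continuous_affine (circle_num om phi)). intros; apply circle_num_continuous, Hphi.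
  - unfold H. replace (/ om * PI + - (2 * PI / om)) with (- h).
    2: { rewrite <- Hh. field. lra. }
    unfold h. rewrite circle_edge. fold h. rewrite gpi. ring.
  - intros s Hs.
    assert (EH : H s = (g s * den (expi s) - num (expi s))%C).
    { unfold H. set (t := / om * s + - (2 * PI / om)).
      assert (Et : om * t = s - 2 * PI) by (unfold t; field; lra).
      rewrite <- (expi_2PI_minus s), <- Et.
      destruct (Hval t) as [_ [-> ->]]. 2: reflexivity.
      split; apply Rmult_lt_reg_l with om; lra. }
    rewrite EH.
    assert (G := gronwall (fun s => g s * den (expi s) - num (expi s))%C
      (fun s => Ci * expi s * (RtoC (/ 2) * coef_q l mu (expi s) - g s / (2 * Ci * om * expi s)))%C
      s (2 * PI) M ltac:(lra)).
    simpl in G. rewrite E2 in G. eapply Rle_trans. apply G.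
    + intros t Ht. assert (Hft : follows l mu om F g t) by (apply HF; lra). split.
      * destruct Hft as [R1 L1]. assert (Eg := locally_singleton _ _ L1). simpl in Eg.
        apply curve_along_circle with (fun z => F t z * den z - num z)%C.
        -- revert L1. apply filter_imp. intros t' E. rewrite E. reflexivity.
        -- rewrite Eg. rewrite RtoC_inv by lra.
           replace (/ RtoC 2 * coef_q l mu (expi t))%C with (coef_q l mu (expi t) / 2)%C
             by (unfold Cdiv; ring).
           apply riccati_defect. lra. apply expi_neq_0. exact R1. apply Hsys, Hpc. lra.
      * eapply Rle_trans. apply circle_coefficient_bound; lra.
        apply Rplus_le_compat_l. apply Rmult_le_compat_r.
        apply Rlt_le, Rinv_0_lt_compat; lra. apply HK. lra.
    + apply Rmult_le_compat_l. apply Cmod_ge_0.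
      assert (0 <= M).
      { assert (P1 := Rabs_pos l). assert (P2 := Rabs_pos mu).
        assert (0 <= K). { eapply Rle_trans; [apply Cmod_ge_0 | apply (HK 0); lra]. }
        unfold M. assert (0 <= K / (2 * om)) by (apply Rdiv_le_0_compat; lra). lra. }
      destruct (Rle_lt_or_eq_dec (M * (2 * PI - s)) (M * PI)) as [Hlt | ->].
      * apply Rmult_le_compat_l; lra.
      * apply Rlt_le, exp_increasing, Hlt.
      * apply Rle_refl. }
rewrite g2pi in Z.
replace (PhiM (RtoC 1) * den (RtoC 1))%C
  with (PhiM (RtoC 1) * den (RtoC 1) - num (RtoC 1) + num (RtoC 1))%C by ring.
rewrite Z. ring.
Qed.

Theorem theorem4 (l mu om : R) (hom : 0 < om)
  (U W : C -> Prop) (Phi Psi PhiM sPsi sPhi : C -> C) (phi : R -> R)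
  (hU : circle_vicinity U) (hW : circle_vicinity W)
  (hWU : forall z, W z -> U z /\ U (/ z)%C)
  (hPhi : riccati_solution l mu om U Phi)
  (hPsi : psi_solution om U Phi Psi)
  (hPsi1 : Psi (RtoC 1) = RtoC 1)
  (hPhi1 : Cmod (Phi (RtoC 1)) = 1)
  (hphi : is_phase om Phi phi)
  (hsPsi : is_sqrt_branch om U Psi
             (fun t => RtoC (exp (phase_integral phi t / 2))) sPsi)
  (hsPhi : is_sqrt_branch om U Phi (fun t => expi (phi t / 2)) sPhi)
  (hPhiM : monodromy_transform l mu om W Phi PhiM) :
  forall z, W z ->
    (PhiM z * monodromy_den om phi sPsi sPhi z
       = monodromy_num om phi sPsi sPhi z)%C /\
    (Phi (RtoC 1) <> Ci -> Phi (RtoC 1) <> (- Ci)%C ->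
       monodromy_den om phi sPsi sPhi z <> RtoC 0 /\
       PhiM z = (monodromy_num om phi sPsi sPhi z
                 / monodromy_den om phi sPsi sPhi z)%C).
Proof.
assert (Hpi := PI_RGT_0). assert (Hh := half_period om hom).
assert (Hh0 : 0 < period om / 2) by nra.
assert (Hom : om <> 0) by lra.
assert (hx := branch_linear_system l mu om U Phi Psi sPsi sPhi _ _ Hom hU hPhi hPsi hPsi1 hsPsi hsPhi).
destruct hphi as [Hp1 [Hp2 Hp3]].
(* Outside [-T/2, T/2] the phase is arbitrary; replacing it by a continuous one
   changes none of the quantities in the formula. *)
destruct (continuous_extension phi _ Hh0 (fun t Ht => proj1 (Hp1 t Ht)) Hp2 Hp3)
  as [psi [Cpsi Epsi]].
assert (EP : forall t, - (period om / 2) <= t <= period om / 2 ->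
  phase_integral psi t = phase_integral phi t).
{ intros t Ht. apply phase_integral_ext with (period om / 2); assumption. }
assert (Ea : coef_direct om phi = coef_direct om psi).
{ unfold coef_direct. rewrite EP, Epsi by lra. reflexivity. }
assert (Eb : coef_inverse om phi = coef_inverse om psi).
{ unfold coef_inverse. rewrite EP, !Epsi by lra. reflexivity. }
assert (En : forall z, monodromy_num om phi sPsi sPhi z = monodromy_num om psi sPsi sPhi z).
{ intros z. unfold monodromy_num. rewrite Ea, Eb. reflexivity. }
assert (Ed : forall z, monodromy_den om phi sPsi sPhi z = monodromy_den om psi sPsi sPhi z).
{ intros z. unfold monodromy_den. rewrite Ea, Eb. reflexivity. }
assert (hsPsi' : is_sqrt_branch om U Psi (fun t => RtoC (exp (phase_integral psi t / 2))) sPsi).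
{ split. apply hsPsi. intros t Ht. rewrite (proj2 hsPsi t Ht), EP by lra. reflexivity. }
assert (hsPhi' : is_sqrt_branch om U Phi (fun t => expi (psi t / 2)) sPhi).
{ split. apply hsPhi. intros t Ht. rewrite (proj2 hsPhi t Ht), Epsi by lra. reflexivity. }
assert (pU : forall z, punctured_circle z -> U z) by apply hU.
assert (pUi : forall z, punctured_circle z -> U (/ z)%C).
{ intros z Hz. apply hWU. apply hW. exact Hz. }
assert (sU : forall z, U z -> z <> RtoC 0).
{ intros z Uz. apply slit_plane_neq_0. apply hU. exact Uz. }
assert (Hsys : forall z, U z -> U (/ z)%C ->
  linear_system l mu om (monodromy_num om psi sPsi sPhi) (monodromy_den om psi sPsi sPhi) z).
{ intros z Uz Uz'. apply monodromy_linear_system; auto. }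
assert (Hval := fun t => monodromy_on_circle om U Phi Psi psi sPsi sPhi t hsPsi' hsPhi').
destruct hPhiM as [HM Hcont].
assert (H1 : (PhiM (RtoC 1) * monodromy_den om psi sPsi sPhi (RtoC 1)
   = monodromy_num om psi sPsi sPhi (RtoC 1))%C).
{ apply (monodromy_at_1 l mu om Phi PhiM _ _ psi hom Cpsi).
  - intros z Hz. apply hPhi, pU, Hz.
  - intros z Hz. apply Hsys; auto.
  - intros t Ht. split; [| apply Hval, Ht].
    rewrite Epsi by lra. apply (Hp1 t Ht).
  - apply Hcont, punctured_circle_1. }
destruct hW as [oW [cW [sW pW]]].
assert (Hq : forall z, W z ->
  @ex_derive C_AbsRing C_NormedModule (fun w => coef_q l mu w / 2)%C z).
{ intros z Wz. apply coef_q_holomorphic, sU, hWU, Wz. }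
assert (HG : forall z, W z ->
  @ex_derive C_AbsRing C_NormedModule (fun w => PhiM w / (2 * Ci * om * w))%C z).
{ intros z Wz. apply (riccati_quotient_holomorphic l mu); auto. apply sU, hWU, Wz. }
assert (Hsol : forall z, W z -> (PhiM z * monodromy_den om psi sPsi sPhi z
   = monodromy_num om psi sPsi sPhi z)%C).
{ intros z Wz.
  assert (Z : (PhiM z * monodromy_den om psi sPsi sPhi z - monodromy_num om psi sPsi sPhi z)%C = RtoC 0).
  { apply (zero_propagates W
      (fun w => PhiM w * monodromy_den om psi sPsi sPhi w - monodromy_num om psi sPsi sPhi w)%C
      (fun w => coef_q l mu w / 2 - PhiM w / (2 * Ci * om * w))%C (RtoC 1) oW cW).
    - intros w Ww. destruct (hWU w Ww) as [U1 U2]. apply riccati_defect; auto.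
    - intros w Ww. destruct (Hq w Ww) as [d1 D1]. destruct (HG w Ww) as [d2 D2].
      eexists. apply hol_minus; eassumption.
    - apply pW, punctured_circle_1.
    - rewrite H1. ring.
    - exact Wz. }
  replace (PhiM z * monodromy_den om psi sPsi sPhi z)%C
    with (PhiM z * monodromy_den om psi sPsi sPhi z - monodromy_num om psi sPsi sPhi z
      + monodromy_num om psi sPsi sPhi z)%C by ring.
  rewrite Z. ring. }
intros z Wz. rewrite En, Ed. split. exact (Hsol z Wz).
intros NI NmI.
assert (Nd : monodromy_den om psi sPsi sPhi z <> RtoC 0).
{ intros E.
  (* Substituting num = PhiM den, the second equation of the system becomes a
     scalar homogeneous equation for den. *)
  assert (D1 : monodromy_den om psi sPsi sPhi (RtoC 1) = RtoC 0).
  { apply (zero_propagates W (monodromy_den om psi sPsi sPhi)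
      (fun w => PhiM w / (2 * Ci * om * w) - coef_q l mu w / 2)%C z oW cW); auto.
    - intros w Ww. destruct (hWU w Ww) as [U1 U2].
      refine (hol_eq _ _ _ _ (proj2 (Hsys w U1 U2)) _).
      rewrite <- (Hsol w Ww). unfold Cdiv. ring.
    - intros w Ww. destruct (Hq w Ww) as [d1 D1]. destruct (HG w Ww) as [d2 D2].
      eexists. apply hol_minus; eassumption.
    - apply pW, punctured_circle_1. }
  assert (N1 : monodromy_num om psi sPsi sPhi (RtoC 1) = RtoC 0).
  { rewrite <- H1, D1. ring. }
  assert (E0 : expi (om * 0) = RtoC 1) by (rewrite Rmult_0_r; apply expi_0).
  assert (C0 : cos (psi 0) = 0).
  { apply (degenerate_coefficients om psi).
    - apply (circle_wronskian l mu om (fun w => sPsi w * sPhi w)%C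
        (fun w => sPsi w * / sPhi w)%C psi hom Cpsi).
      + intros w Hw. apply hx, pU, Hw.
      + intros t Ht. rewrite (proj2 hsPsi' t Ht), (proj2 hsPhi' t Ht).
        unfold circle_x, circle_y. rewrite expi_opp. split; reflexivity.
    - destruct (Hval 0) as [V _]. lra. rewrite <- V, E0. exact N1. }
  rewrite Epsi in C0 by lra.
  assert (P0 := proj2 (Hp1 0 ltac:(lra))). rewrite E0 in P0.
  destruct (expi_cos_0 _ C0) as [V | V]; rewrite V in P0; contradiction. }
split. exact Nd.
rewrite <- (Hsol z Wz). field. exact Nd.
Qed.
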